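(* Let $q$ be a positive integer. There exists an infinite family of (pairwise non-isomorphic) trees $T$ with $\mu(T)=2q+1$ that satisfy $$a(T)-\alpha(T)= \frac{\mu(T)}{2}-\frac12 .$$
   Context: All graphs are finite, undirected, without loops or multiple edges. For a graph $G$, $m(G)$ is its number of edges, $\alpha(G)$ is its independence number, and $\mu(G)$ is its matching number (maximum size of a set of edges no two of which share a vertex). If $d_1\le d_2\le\cdots\le d_n$ is the degree sequence of $G$, the annihilation number $a(G)$ is the largest integer $k\in\{0,\dots,n\}$ such that $\sum_{i=1}^k d_i\le m(G)$. *)

(* Defs.v *)
From HB Require Import structures.
From mathcomp Require Import all_boot all_order all_algebra.

Set Implicit Arguments.
Unset Strict Implicit.
Unset Printing Implicit Defensive.

Record sgraph := SGraph {
  vertex :> finType;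
  adj : rel vertex;
  adj_sym : symmetric adj;
  adj_irrefl : irreflexive adj }.

Section Invariants.
Variable G : sgraph.

Definition edges : {set {set G}} :=
  [set e | [exists x : G, exists y : G, adj x y && (e == [set x; y])]].

Definition num_edges : nat := #|edges|.

Definition degree (x : G) : nat := #|[set y | adj x y]|.

Definition independent (S : {set G}) : bool :=
  [forall x in S, forall y in S, ~~ adj x y].

Definition independence_number : nat :=
  \max_(S : {set G} | independent S) #|S|.

Definition matching (M : {set {set G}}) : bool :=
  (M \subset edges) && trivIset M.

Definition matching_number : nat :=
  \max_(M : {set {set G}} | matching M) #|M|.

Definition degree_sequence : seq nat :=
  sort leq [seq degree x | x <- enum G].

Definition annihilation_number : nat :=
  \max_(k < #|G|.+1 | sumn (take k degree_sequence) <= num_edges) k.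

Definition connected : Prop :=
  0 < #|G| /\ forall x y : G, connect (@adj G) x y.

(* [ucycle] admits the degenerate cycles of length at most 2 (in particular
   [:: x; y] for every edge xy), hence the bound on the size. *)
Definition acyclic : Prop :=
  forall c : seq G, 2 < size c -> ~ ucycle (@adj G) c.

Definition tree : Prop := connected /\ acyclic.

End Invariants.

Definition isomorphic (G H : sgraph) : Prop :=
  exists2 f : G -> H, bijective f & {mono f : x y / adj x y}.

(* Main.v *)
(** Take [q + 1] hubs carrying [k > 0] leaves each, join the first hub to the other
    [q] hubs, and attach [q] pendant paths with two vertices (a middle vertex and
    a tip) to the first hub.  The hubs and the middle vertices form a vertex cover
    of size [2q + 1], and each of them can be matched with a private leaf; hence
    the matching number is [2q + 1] and the independence number is
    [n - (2q + 1)].  The vertices other than the hubs have the smallest degrees,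
    and their degrees sum to [(q + 1) k + 3q = n - 1 = m]; hence the annihilation
    number is [n - (q + 1)]. *)

Require Import Defs.
From mathcomp Require Import all_boot all_order all_algebra.
From mathcomp Require Import zify ring.

Set Implicit Arguments.
Unset Strict Implicit.
Unset Printing Implicit Defensive.

Import GRing.Theory Num.Theory.

Lemma bigmax_eq (I : finType) (P : pred I) (F : I -> nat) (i0 : I) :
  P i0 -> (forall i, P i -> F i <= F i0) -> \max_(i | P i) F i = F i0.
Proof.
move=> Pi0 le_F; apply/eqP; rewrite eqn_leq; apply/andP; split.
  by apply/bigmax_leqP.
exact: leq_bigmax_cond.
Qed.

Lemma isomorphic_card (G H : sgraph) : isomorphic G H -> #|G| = #|H|.
Proof. by case=> f /bij_eq_card. Qed.

(** * Matchings against vertex covers, and annihilation numbers from a degree threshold *)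

Section Invariants.
Variable G : sgraph.
Implicit Types (S C H : {set G}) (M : {set {set G}}).

Lemma edgesP (e : {set G}) :
  reflect (exists x y, adj x y /\ e = [set x; y]) (e \in edges G).
Proof.
rewrite inE; apply: (iffP existsP) => [[x /existsP[y /andP[xy /eqP->]]]|].
  by exists x, y.
by case=> x [y [xy ->]]; exists x; apply/existsP; exists y; rewrite xy eqxx.
Qed.

Lemma independentP S :
  reflect {in S &, forall x y, ~~ adj x y} (independent S).
Proof.
apply: (iffP forall_inP) => [ind x y xS yS|ind x xS].
  by move/forall_inP: (ind x xS); apply.
by apply/forall_inP => y; apply: ind.
Qed.

(** Independence of [~: C] says that [C] is a vertex cover. Choosing in each edge of [M] an endpoint
    in [C] is injective, since the edges of [M] are disjoint. *)
Lemma matching_leq_cover M C :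
  matching M -> independent (~: C) -> #|M| <= #|C|.
Proof.
case/andP=> /subsetP sME /trivIsetP tM /independentP indC.
have meet e : e \in M -> exists2 x, x \in e & x \in C.
  move=> /sME/edgesP[x [y [xy ->]]].
  have [xC|xC] := boolP (x \in C); first by exists x; rewrite ?set21.
  have [yC|yC] := boolP (y \in C); first by exists y; rewrite ?set22.
  by have := indC x y; rewrite !inE xC yC xy => /(_ isT isT).
(* A nonempty [M] supplies the vertex [x0], the default value of [f]; [meet] shows that the default
   is never taken on [M]. *)
have [->|[e0 e0M]] := set_0Vmem M; first by rewrite cards0.
have [x0 _ _] := meet _ e0M.
pose f (e : {set G}) := odflt x0 [pick x in e :&: C].
have fP e : e \in M -> (f e \in e) && (f e \in C).
  move=> /meet[x xe xC]; rewrite /f; case: pickP => [y|/(_ x)].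
    by rewrite inE.
  by rewrite inE xe xC.
have f_inj : {in M &, injective f}.
  move=> e1 e2 e1M e2M ef; apply/eqP; apply: contraT => /(tM _ _ e1M e2M).
  move/disjointFr => /(_ (f e1)); case/andP: (fP _ e1M) => -> _ /(_ isT).
  by rewrite ef; case/andP: (fP _ e2M) => ->.
rewrite -(card_in_imset f_inj); apply/subset_leq_card/subsetP => x.
by case/imsetP => e /fP/andP[_ fC] ->.
Qed.

Lemma matching_number_cover M C :
  matching M -> independent (~: C) -> #|M| = #|C| -> matching_number G = #|C|.
Proof.
move=> mM iC eMC; rewrite -eMC; apply: bigmax_eq => // M' mM'.
by rewrite eMC; apply: matching_leq_cover.
Qed.

(** The complement of an independent set is a vertex cover, hence has at least [#|M| = #|C|]
    vertices. *)
Lemma independence_number_cover M C :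
  matching M -> independent (~: C) -> #|M| = #|C| ->
  independence_number G = #|~: C|.
Proof.
move=> mM iC eMC; apply: (bigmax_eq (F := fun S => #|S|)) => // S iS.
have := matching_leq_cover (C := ~: S) mM; rewrite setCK => /(_ iS).
by have := cardsC C; have := cardsC S; rewrite eMC; lia.
Qed.

Lemma degree_sequence_split H t :
    (forall x, x \notin H -> degree x <= t) ->
    (forall x, x \in H -> t <= degree x) ->
  degree_sequence G = sort leq [seq degree x | x <- enum (~: H)]
                      ++ sort leq [seq degree x | x <- enum H].
Proof.
move=> le_t ge_t; apply: (sorted_eq leq_trans anti_leq).
- exact: sort_sorted leq_total _.
- rewrite (sorted_pairwise leq_trans) pairwise_cat -!(sorted_pairwise leq_trans).
  rewrite !sort_sorted ?andbT; try exact: leq_total.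
  apply/allrelP => a b; rewrite !mem_sort => /mapP[x + ->] /mapP[y + ->].
  by rewrite !mem_enum inE => /le_t xt /ge_t; apply: leq_trans.
rewrite perm_sort perm_sym.
apply: (@perm_trans _ ([seq degree x | x <- enum (~: H)]
                       ++ [seq degree x | x <- enum H])).
  by apply: perm_cat; rewrite perm_sort.
rewrite -map_cat; apply/perm_map/uniq_perm; rewrite ?enum_uniq //.
  rewrite cat_uniq !enum_uniq andbT /=; apply/hasPn => x.
  by rewrite /= !mem_enum inE negbK.
by move=> x; rewrite mem_cat !mem_enum !inE orNb.
Qed.

(** The degrees outside [H] form an initial segment of the degree sequence and already use up all of
    [num_edges G]; every later degree is at least [t > 0], so any longer prefix overshoots. *)
Lemma annihilation_number_split H t :
    0 < t -> (forall x, x \notin H -> degree x <= t) ->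
    (forall x, x \in H -> t <= degree x) ->
    \sum_(x in ~: H) degree x = num_edges G ->
  annihilation_number G = #|~: H|.
Proof.
move=> t_gt0 le_t ge_t sumE.
rewrite /annihilation_number (degree_sequence_split le_t ge_t).
set A := sort _ _; set B := sort _ _.
have szA : size A = #|~: H| by rewrite size_sort size_map -cardE.
have sumA : sumn A = num_edges G.
  rewrite -sumE (perm_sumn (permEl (perm_sort _ _))) sumnE big_map big_enum.
  by apply: eq_bigl => x.
have szB : size B = #|H| by rewrite size_sort size_map -cardE.
have ltn : #|~: H| < #|G|.+1 by rewrite ltnS max_card.
rewrite (bigmax_eq (i0 := Ordinal ltn)) //= -szA.
  by rewrite take_size_cat // sumA.
move=> [k /= lt_kn]; rewrite take_cat; case: ltnP => [/ltnW //|].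
case: ltngtP => // lt_k _; rewrite sumn_cat sumA.
(* A prefix longer than [A] must take the head of [B]; if [H] were empty, [k] would exceed the
   number of vertices. *)
have: B != [::].
  rewrite -size_eq0 szB; apply: contraTneq lt_kn => H0.
  by rewrite -leqNgt -(cardsC H) H0 -szA.
have: all (leq t) B.
  rewrite all_sort all_map; apply/allP => x /=; rewrite mem_enum; exact: ge_t.
case: B {szB} => // b B /= /andP[tb _] _.
by rewrite -(prednK (_ : 0 < k - size A)) ?subn_gt0 //=; lia.
Qed.

End Invariants.

(** * Trees given by a parent function *)

Section ParentTree.
Variables (V : finType) (r : V) (p : V -> V) (d : V -> nat).
Hypothesis d_parent : forall x, x != r -> d (p x) < d x.

(* The value of [p] at the root [r] is a junk value. *)
Definition parent_adj : rel V :=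
  fun x y => (x != r) && (y == p x) || (y != r) && (x == p y).

Lemma parent_adj_sym : symmetric parent_adj.
Proof. by move=> x y; rewrite /parent_adj orbC. Qed.

Lemma parent_adj_irrefl : irreflexive parent_adj.
Proof.
move=> x; rewrite /parent_adj orbb; apply/negP => /andP[/d_parent + /eqP e].
by rewrite -e ltnn.
Qed.

Definition parent_graph : sgraph := SGraph parent_adj_sym parent_adj_irrefl.

Lemma parent_graph_connected : connected parent_graph.
Proof.
have to_root (x : parent_graph) : connect (@adj parent_graph) x r.
  elim/ltn_ind: (d x) {-2}x (erefl (d x)) => n IH {}x dx.
  have [->//|xr] := eqVneq x r.
  apply: (connect_trans (y := p x)).
    by apply: connect1; rewrite /= /parent_adj xr eqxx.
  by apply: IH (erefl _); rewrite -dx d_parent.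
split; first by apply/card_gt0P; exists r.
move=> x y; apply: connect_trans (to_root x) _.
by rewrite (sym_connect_sym parent_adj_sym).
Qed.

(* In a cycle, both neighbours of a vertex of maximal depth are its parent. *)
Lemma parent_graph_acyclic : acyclic parent_graph.
Proof.
move=> c sz_c /andP[cyc_c uniq_c].
have [x0 x0c] : exists x, x \in c.
  by case: c sz_c {cyc_c uniq_c} => // x c _; exists x; rewrite mem_head.
case: (arg_maxnP d x0c) => x xc max_x.
have up y : y \in c -> parent_adj x y -> y = p x.
  move=> yc /orP[/andP[_ /eqP]//|/andP[/d_parent + /eqP xy]].
  by rewrite -xy ltnNge => /negP[]; apply: max_x.
case/rot_to: xc => i s def_c.
have mem_s y : y \in s -> y \in c.
  by move=> ys; rewrite -(mem_rot i) def_c inE ys orbT.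
move: cyc_c uniq_c sz_c; rewrite -(rot_cycle i) -(rot_uniq i) -(size_rot i).
rewrite def_c; case: s mem_s {def_c} => [|y [|z s]] // mem_s.
rewrite (cycle_path x) /= => /and4P[last_x xy _ _].
(* The two neighbours of [x] on the cycle, [y] and [last z s], are both [p x], so a vertex
   repeats. *)
have -> : y = p x by apply: up xy; rewrite mem_s ?mem_head.
have <- : last z s = p x.
  by apply: up; [rewrite mem_s // inE mem_last orbT | rewrite parent_adj_sym].
by rewrite mem_last /= andbF.
Qed.

Lemma parent_graph_tree : tree parent_graph.
Proof. by split; [exact: parent_graph_connected | exact: parent_graph_acyclic]. Qed.

(** Each edge joins exactly one non-root vertex to its parent: if two vertices gave the same edge,
    each would be the parent of the other, against the strict decrease of [d]. *)
Lemma num_edges_parent_graph : num_edges parent_graph = #|V|.-1.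
Proof.
have -> : num_edges parent_graph = #|[set [set x; p x] | x in [set~ r]]|.
  apply: eq_card => e; apply/edgesP/imsetP.
    case=> x [y [/orP[]/andP[xr /eqP def_y] ->]].
      by exists x; rewrite ?in_setC1 // def_y.
    by exists y; rewrite ?in_setC1 // def_y setUC.
  case=> x; rewrite in_setC1 => xr ->; exists x, (p x); split=> //.
  by rewrite /= /parent_adj xr eqxx.
rewrite card_in_imset ?cardsC1 // => x y; rewrite !in_setC1 => xr yr e.
have := set21 y (p y); rewrite -e; have := set21 x (p x); rewrite {1}e !in_set2.
case/predU1P=> [->//|/eqP x_py] /predU1P[->//|/eqP y_px].
have := ltn_trans (d_parent xr) (_ : d x < d (p x)).
by rewrite ltnn -y_px {1}x_py (d_parent yr) => /(_ isT).
Qed.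

End ParentTree.

(** * The trees built from hubs, and their invariants *)

Section HubTree.
Variables q k : nat.

(* [None] is the first hub; the summands [inr] of [cover] and [leaf] are the
   middle vertices and the tips. *)
Let hub := option 'I_q.
Let cover := (hub + 'I_q)%type.
Let leaf := (hub * 'I_k.+1 + 'I_q)%type.
Let V := (cover + leaf)%type.
Let root : V := inl (inl None).

Let leaf_parent (l : leaf) : cover :=
  match l with inl (h, _) => inl h | inr i => inr i end.

Let parent (x : V) : V :=
  match x with inl _ => root | inr l => inl (leaf_parent l) end.

(** Only the strict decrease towards the root matters: leaves of the first hub also get depth 2,
    although they are at distance 1 from it. *)
Let depth (x : V) : nat :=
  match x with inl (inl None) => 0 | inl _ => 1 | inr _ => 2 end.

Lemma hub_tree_depth x : x != root -> depth (parent x) < depth x.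
Proof. by case: x => [[[]|]|[[[]]|]]. Qed.

Definition hub_tree : sgraph := parent_graph hub_tree_depth.

Lemma card_hub_tree : #|hub_tree| = q.+1 + q + (q.+1 * k.+1 + q).
Proof. by rewrite !card_sum card_prod card_option !card_ord. Qed.

Lemma hub_tree_tree : tree hub_tree.
Proof. exact: parent_graph_tree. Qed.

Let cover_set : {set hub_tree} := [set x | if x is inl _ then true else false].
Let hub_set : {set hub_tree} :=
  [set x | if x is inl (inl _) then true else false].

Let own_leaf (c : cover) : leaf :=
  match c with inl h => inl (h, ord0) | inr i => inr i end.

Let own_edge (c : cover) : {set hub_tree} := [set inl c; inr (own_leaf c)].
Let own_matching : {set {set hub_tree}} := [set own_edge c | c : cover].

(** Recovers [c] from either endpoint of [own_edge c], which gives both injectivity and disjointness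
    of the private edges. *)
Let cover_of (x : V) : cover :=
  match x with inl c => c | inr l => leaf_parent l end.

Lemma cover_of_own_edge c x : x \in own_edge c -> cover_of x = c.
Proof. by rewrite in_set2 => /orP[]/eqP-> //; case: c. Qed.

Lemma own_edge_inj : injective own_edge.
Proof.
move=> c c' eq_cc'; apply: (@cover_of_own_edge c' (inl c)).
by rewrite -eq_cc' set21.
Qed.

Lemma matching_own_matching : matching own_matching.
Proof.
apply/andP; split.
  apply/subsetP => _ /imsetP[c _ ->]; apply/edgesP.
  exists (inl c), (inr (own_leaf c)); split=> //.
  by rewrite /= /parent_adj; case: c => [h|i]; rewrite eqxx orbT.
apply/trivIsetP => _ _ /imsetP[c _ ->] /imsetP[c' _ ->] neq.
rewrite disjoint_subset; apply/subsetP => x /cover_of_own_edge xc.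
apply: contra neq => /cover_of_own_edge xc'.
by rewrite -xc -xc'.
Qed.

Lemma independent_setC_cover : independent (~: cover_set).
Proof. by apply/independentP => -[c|l] [c'|l']; rewrite !inE. Qed.

Lemma card_cover_set : #|cover_set| = q.+1 + q.
Proof.
have -> : cover_set = [set inl c | c : cover].
  apply/setP => -[c|l]; rewrite inE.
    by apply/esym/imsetP; exists c.
  by apply/esym/imsetP => -[].
by rewrite card_imset ?card_sum ?card_option ?card_ord // => c c' [].
Qed.

Lemma card_hub_set : #|hub_set| = q.+1.
Proof.
have -> : hub_set = [set inl (inl h) | h : hub].
  apply/setP => -[[h|i]|l]; rewrite inE.
  - by apply/esym/imsetP; exists h.
  - by apply/esym/imsetP => -[].
  - by apply/esym/imsetP => -[].
by rewrite card_imset ?card_option ?card_ord // => h h' [].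
Qed.

Lemma card_own_matching : #|own_matching| = #|cover_set|.
Proof.
rewrite card_cover_set card_imset; last exact: own_edge_inj.
by rewrite card_sum card_option card_ord.
Qed.

Lemma matching_number_hub_tree : matching_number hub_tree = q.+1 + q.
Proof.
rewrite -card_cover_set; apply: matching_number_cover card_own_matching.
  exact: matching_own_matching.
exact: independent_setC_cover.
Qed.

Lemma independence_number_hub_tree :
  independence_number hub_tree + (q.+1 + q) = #|hub_tree|.
Proof.
rewrite (independence_number_cover matching_own_matching independent_setC_cover).
  by rewrite -card_cover_set addnC cardsC.
exact: card_own_matching.
Qed.

Lemma degree_mid i : degree (inl (inr i) : hub_tree) = 2.
Proof.
have <- : #|[set root; inr (inr i)]| = 2 by rewrite cards2.
apply: eq_card => -[[[h|]|j]|[[h j]|j]]; rewrite !inE /= /parent_adj //=.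
by rewrite [LHS]eq_sym.
Qed.

Lemma degree_leaf l : degree (inr l : hub_tree) = 1.
Proof.
have <- : #|[set parent (inr l)]| = 1 by rewrite cards1.
by apply: eq_card => -[c|l']; rewrite !inE /= /parent_adj /= ?andbF ?orbF.
Qed.

Lemma degree_hub h : 0 < q -> 2 <= degree (inl (inl h) : hub_tree).
Proof.
(* [x] is a neighbouring hub; for the first hub it exists because [q > 0]. The second neighbour is
   the private leaf. *)
move=> q_gt0; pose x : V := inl (inl (if h is None then Some (Ordinal q_gt0) else None)).
have <- : #|[set x; inr (inl (h, ord0))]| = 2 by rewrite cards2.
apply/subset_leq_card/subsetP => y.
rewrite in_set2 inE /= /parent_adj => /orP[]/eqP ->; last by rewrite eqxx orbT.
by case: h @x.
Qed.

Lemma sum_degree_setC_hub :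
  \sum_(x in ~: hub_set) degree x = num_edges hub_tree.
Proof.
rewrite num_edges_parent_graph card_hub_tree.
rewrite big_mkcond !big_sumType /=.
rewrite [X in X + _ + _]big1 => [|h _]; last by rewrite !inE.
under eq_bigr => i _ do rewrite !inE degree_mid.
under [X in _ + (X + _)]eq_bigr => i _ do rewrite !inE degree_leaf.
under [X in _ + (_ + X)]eq_bigr => i _ do rewrite !inE degree_leaf.
rewrite !sum_nat_const card_prod card_option !card_ord; lia.
Qed.

Lemma annihilation_number_hub_tree : 0 < q ->
  annihilation_number hub_tree + q.+1 = #|hub_tree|.
Proof.
(* The threshold 2 is the degree of the middle vertices, the largest one outside the hubs. *)
move=> q_gt0; rewrite (@annihilation_number_split _ hub_set 2) //.
- by rewrite -card_hub_set addnC cardsC.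
- by case=> [[h|i]|l]; rewrite !inE ?degree_mid ?degree_leaf.
- by case=> [[h|i]|l]; rewrite !inE // => _; apply: degree_hub.
- exact: sum_degree_setC_hub.
Qed.

End HubTree.

Local Open Scope ring_scope.

Theorem theorem2p9 (q : nat) (hq : (0 < q)%N) :
  exists T : nat -> sgraph,
    (forall i j : nat, i <> j -> ~ isomorphic (T i) (T j)) /\
    (forall i : nat,
       tree (T i) /\
       matching_number (T i) = (2 * q + 1)%N /\
       (annihilation_number (T i))%:R - (independence_number (T i))%:R
         = (matching_number (T i))%:R / 2%:R - 1 / 2%:R :> rat).
Proof.
exists (hub_tree q); split=> [i j ij|i].
  (* The number of vertices grows strictly with the index; each hub of [hub_tree q i] carries [i.+1]
     leaves, so the index 0 is allowed. *)
  by move/isomorphic_card; rewrite !card_hub_tree; nia.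
have matchE := matching_number_hub_tree q i.
split; first exact: hub_tree_tree.
split; first by rewrite matchE; lia.
(* The two numbers are [n - (q + 1)] and [n - (2q + 1)], where [n] counts the vertices; their
   difference [q] is half of [2q + 1] minus one half. *)
have -> : annihilation_number (hub_tree q i)
        = (independence_number (hub_tree q i) + q)%N.
  have := annihilation_number_hub_tree i hq.
  by have := independence_number_hub_tree q i; lia.
by rewrite matchE !natrD -natr1; field.
Qed.
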